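(* Let $(X,d)$ be a compact metric space, let $f_1,f_2:X\to X$ be continuous maps, and let $F=\{f_1,f_2\}$ be the associated multiple mappings. If $f_1\circ f_2=f_2\circ f_1$ and there exists $p\in X$ such that $f_1^n(p)=p$ for some integer $n>0$ and $f_2^m(p)=p$ for some integer $m>0$, then $p$ is a periodic point of $F$.
   Context: For $F=\{f_1,f_2\}$, an integer $n>0$ and $x\in X$, put $$F^n(x)=\{f_{i_1}f_{i_2}\cdots f_{i_n}(x)\mid i_1,\dots,i_n\in\{1,2\}\}\subset X,$$ where juxtaposition denotes composition; in particular $F(x)=F^1(x)=\{f_1(x),f_2(x)\}$. The deleted orbit of $x$ under $F$ is the set of subsets $\mathring{orb}(x,F)=\{F(x),F^2(x),F^3(x),\dots\}$. A point $x\in X$ is a periodic point of $F$ if $\mathring{orb}(x,F)$ is finite (as a set of subsets of $X$) and there exists an integer $m>0$ such that $x\in F^m(x)$. *)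

(* Defs.v *)
From mathcomp Require Import all_boot all_algebra.
From mathcomp Require Import all_classical all_reals all_analysis.

Set Implicit Arguments.
Unset Strict Implicit.
Unset Printing Implicit Defensive.

Local Open Scope classical_set_scope.

Section MultipleMappings.
Variables (T : Type) (f1 f2 : T -> T).

(* The index set {1, 2} is encoded by bool: true stands for 1, false for 2. *)
Definition mm_map (i : bool) : T -> T := if i then f1 else f2.

(* For w = [:: i_1; ...; i_n] this is f_{i_1} (f_{i_2} (... (f_{i_n} x))). *)
Definition mm_word (w : seq bool) (x : T) : T := foldr mm_map x w.

(* F^n(x), for F = {f1, f2} *)
Definition mm_iter (n : nat) (x : T) : set T :=
  [set mm_word w x | w in [set: n.-tuple bool]].

Definition deleted_orbit (x : T) : set (set T) :=
  [set mm_iter n x | n in [set n | (0 < n)%N]].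

Definition periodic_point (x : T) : Prop :=
  finite_set (deleted_orbit x) /\ exists m, (0 < m)%N /\ mm_iter m x x.

End MultipleMappings.

(* Main.v *)
(* By commutativity every word in f1, f2 sends p to f1^i f2^j p, and the exponents may be
   reduced modulo the two periods, so all the sets F^k(p) are subsets of one finite set. *)
Require Import Defs.
From mathcomp Require Import all_boot all_algebra.
From mathcomp Require Import all_classical all_reals all_analysis.

Local Open Scope classical_set_scope.

(** The normal form of words ([mm_wordE]) and reduction of exponents ([iter_modn]) put every
    [F^k(p)] inside the image of ['I_n * 'I_m]. A finite set has finitely many subsets
    ([finite_subsets]), so the deleted orbit is finite, and [f1^n(p) = p] gives the return to
    [p]. *)

Lemma iter_modn (T : Type) (f : T -> T) (n : nat) (x : T) :
  iter n f x = x -> forall k, iter k f x = iter (k %% n) f x.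
Proof.
move=> fx k; rewrite {1}(divn_eq k n) addnC iterD; congr (iter _ f _).
by rewrite iterM; elim: (k %/ n) => //= q ->.
Qed.

Lemma iter_comm (T : Type) (f g : T -> T) :
  f \o g = g \o f -> forall i j x, iter i f (iter j g x) = iter j g (iter i f x).
Proof.
move=> fg i j x.
have fgE y : f (g y) = g (f y) by rewrite -[LHS]/((f \o g) y) fg.
have fgj k y : f (iter k g y) = iter k g (f y) by elim: k => //= k <-.
by elim: i => //= i ->; rewrite fgj.
Qed.

Lemma mm_wordE (T : Type) (f1 f2 : T -> T) :
  f1 \o f2 = f2 \o f1 -> forall w x,
  mm_word f1 f2 w x = iter (count id w) f1 (iter (count negb w) f2 x).
Proof.
move=> f12 w x; elim: w => //= -[] w; rewrite /mm_word /= => -> //.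
by rewrite -[LHS]/(iter 1 f2 _) -(iter_comm _ _ _ f12).
Qed.

(** Each such [B] is the image under [h] of its own preimage, and the finite type [I] has finitely
    many subsets. *)
Lemma finite_subsets (T : Type) (I : finType) (h : I -> T) (C : set (set T)) :
  (forall B, C B -> B `<=` range h) -> finite_set C.
Proof.
move=> Ch; pose g (S : {set I}) : set T := [set h i | i in [set` S]].
apply: (@sub_finite_set _ _ (range g)); last first.
  exact/finite_image/finite_finset.
move=> B CB; exists [set i | `[< B (h i) >]]%SET => //.
rewrite /g; apply/seteqP; split=> [x [i /=]|x Bx].
  by rewrite inE => /asboolP Bhi <-.
have [i _ hix] := Ch _ CB x Bx.
by exists i => //=; rewrite inE; apply/asboolP; rewrite hix.
Qed.

Theorem theorem3p4 (R : realType) (X : metricType R)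
    (Xcompact : compact [set: X])
    (f1 f2 : X -> X) (f1_cont : continuous f1) (f2_cont : continuous f2)
    (f12_comm : f1 \o f2 = f2 \o f1)
    (p : X)
    (f1_per : exists n, (0 < n)%N /\ iter n f1 p = p)
    (f2_per : exists m, (0 < m)%N /\ iter m f2 p = p) :
  periodic_point f1 f2 p.
Proof.
have [n [n0 f1p]] := f1_per; have [m [m0 f2p]] := f2_per.
split; last first.
  (* The word using only [f1], [n] times, returns to [p]. *)
  exists n; split => //; exists (nseq_tuple n true) => //=.
  by rewrite mm_wordE // !count_nseq /= mul1n.
apply: (@finite_subsets _ ('I_n * 'I_m)%type
  (fun ij => iter ij.1 f1 (iter ij.2 f2 p))).
move=> _ [k _ <-] _ [w _ <-]; rewrite mm_wordE //.
exists (Ordinal (ltn_pmod (count id w) n0),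
        Ordinal (ltn_pmod (count negb w) m0)) => //=.
(* The [f1] exponent is reduced at [f2^j(p)] rather than at [p]; this point is also fixed by [f1^n],
   by commutativity. *)
rewrite -(iter_modn _ _ _ _ f2p) -iter_modn //.
by rewrite iter_comm // f1p.
Qed.
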